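(* Let $X$ be a finite set and let $(x,y)\mapsto(\sigma_x(y),\tau_y(x))$ be a non-degenerate set-theoretic solution of the braid equation on $X$ (not necessarily involutive). Let $V=\mathbb{C}X$ and $\check r=\sum_{x,y\in X}e_{x,\sigma_x(y)}\otimes e_{y,\tau_y(x)}\in\mathrm{End}(V\otimes V)$. For $x\in X$ let $\mathbb{V}_x=\sum_{y\in X}e_{\sigma_x(y),y}$ and $\mathbb{W}_x=\sum_{\eta\in X}e_{\tau_x(\eta),\eta}$, with coproducts, for $\eta,y\in X$, $$\Delta(\mathbb{V}_\eta)=\sum_{x,y\in X}e_{\sigma_\eta(x),x}\otimes e_{\sigma_{\tau_x(\eta)}(y),y},\qquad \Delta(\mathbb{W}_y)=\sum_{\eta,x\in X}e_{\tau_{\sigma_x(y)}(\eta),\eta}\otimes e_{\tau_y(x),x}.$$ Let $F=\sum_{x\in X}e_{x,x}\otimes\mathbb{V}_x$ and $\hat F=\sum_{y\in X}\mathbb{W}_y\otimes e_{y,y}$, and for $\mathcal{T}\in\{F,\hat F\}$ and $\mathbb{Y}_x\in\{\mathbb{V}_x,\mathbb{W}_x\}$ put $\check r_{\mathcal{T}}=\mathcal{T}\check r\mathcal{T}^{-1}$ and $\Delta_{\mathcal{T}}(\mathbb{Y}_x)=\mathcal{T}\Delta(\mathbb{Y}_x)\mathcal{T}^{-1}$. Then for all $x\in X$, $\mathcal{T}\in\{F,\hat F\}$ and $\mathbb{Y}_x\in\{\mathbb{V}_x,\mathbb{W}_x\}$, $$\Delta_{\mathcal{T}}(\mathbb{Y}_x)\,\check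 r_{\mathcal{T}}=\check r_{\mathcal{T}}\,\Delta_{\mathcal{T}}(\mathbb{Y}_x),$$ where, for all $x,y,\eta\in X$ respectively, $$\Delta_F(\mathbb{V}_x)=\mathbb{V}_x\otimes\mathbb{V}_x,\qquad \Delta_F(\mathbb{W}_y)=\sum_{\eta,x\in X}e_{\tau_{\sigma_x(y)}(\eta),\eta}\otimes e_{\tau_{\sigma_{\tau_x(\eta)}(y)}(\sigma_\eta(x)),\sigma_\eta(x)},$$ $$\Delta_{\hat F}(\mathbb{V}_\eta)=\sum_{x,y\in X}e_{\sigma_{\tau_{\sigma_x(y)}(\eta)}(\tau_y(x)),\tau_y(x)}\otimes e_{\sigma_{\tau_x(\eta)}(y),y},\qquad \Delta_{\hat F}(\mathbb{W}_y)=\mathbb{W}_y\otimes\mathbb{W}_y,$$ and the twisted matrices are $$\check r_F=\sum_{x,y\in X}e_{x,\sigma_x(y)}\otimes e_{\sigma_x(y),\sigma_{\sigma_x(y)}(\tau_y(x))},\qquad \check r_{\hat F}=\sum_{x,y\in X}e_{\tau_y(x),\tau_{\tau_y(x)}(\sigma_x(y))}\otimes e_{y,\tau_y(x)}.$$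
   Context: $V=\mathbb{C}X$ is the vector space with basis $\{e_x\}_{x\in X}$, and $e_{x,y}\in\mathrm{End}(V)$ is the matrix unit with $e_{x,y}e_w=\delta_{y,w}e_x$. A map $X\times X\to X\times X$, $(x,y)\mapsto(\sigma_x(y),\tau_y(x))$, is a set-theoretic solution of the braid equation if it satisfies $(\check s\times\mathrm{id})(\mathrm{id}\times\check s)(\check s\times\mathrm{id})=(\mathrm{id}\times\check s)(\check s\times\mathrm{id})(\mathrm{id}\times\check s)$ (with $\check s$ the map); equivalently, for all $\eta,x,y\in X$: $\sigma_\eta(\sigma_x(y))=\sigma_{\sigma_\eta(x)}(\sigma_{\tau_x(\eta)}(y))$, $\tau_y(\tau_x(\eta))=\tau_{\tau_y(x)}(\tau_{\sigma_x(y)}(\eta))$, and $\tau_{\sigma_{\tau_x(\eta)}(y)}(\sigma_\eta(x))=\sigma_{\tau_{\sigma_x(y)}(\eta)}(\tau_y(x))$. It is non-degenerate if all $\sigma_x$ and $\tau_y$ are bijections of $X$; in that case $\mathbb{V}_x,\mathbb{W}_x,F,\hat F$ are invertible. The coproducts $\Delta(\mathbb{V}_\eta),\Delta(\mathbb{W}_y)$ are simply the elements of $\mathrm{End}(V\otimes V)$ given by the displayed formulas. *)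

(* Defs.v *)
From HB Require Import structures.
From mathcomp Require Import all_boot all_order all_algebra.
From mathcomp Require Export reals.
From mathcomp.real_closed Require Export complex mxtens.

Set Implicit Arguments.
Unset Strict Implicit.
Unset Printing Implicit Defensive.

Import GRing.Theory.
Local Open Scope ring_scope.

(* A map X * X -> X * X, (x, y) |-> (sigma_x(y), tau_y(x)), is given by
   sigma x y = sigma_x(y) and tau y x = tau_y(x): in both cases the subscript
   is the first argument. *)
Definition pair_map (X : finType) (sigma tau : X -> X -> X) (p : X * X) :
    X * X :=
  (sigma p.1 p.2, tau p.2 p.1).

Definition act12 (X : finType) (s : X * X -> X * X) (t : X * X * X) :
    X * X * X :=
  (s t.1, t.2).

Definition act23 (X : finType) (s : X * X -> X * X) (t : X * X * X) :
    X * X * X :=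
  let q := s (t.1.2, t.2) in (t.1.1, q.1, q.2).

Definition braid_solution (X : finType) (s : X * X -> X * X) : Prop :=
  act12 s \o act23 s \o act12 s =1 act23 s \o act12 s \o act23 s.

Definition nondegenerate_pair (X : finType) (sigma tau : X -> X -> X) : Prop :=
  (forall x, bijective (sigma x)) /\ (forall y, bijective (tau y)).

(* End(V) for V = CX is represented by matrices indexed by #|X|, acting on
   column vectors, the basis vector e_x being number [enum_rank x]; and
   End(V (x) V) by matrices of size #|X| * #|X|, with *t the Kronecker
   product. *)
Definition mxe (R : realType) (X : finType) (x y : X) : 'M[R[i]]_#|X| :=
  delta_mx (enum_rank x) (enum_rank y).
Notation "''e_(' x , y )" := (mxe _ x y) (format "''e_(' x ,  y )") : ring_scope.

Section Operators.
Context (R : realType) (X : finType) (sigma tau : X -> X -> X).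

Definition rcheck : 'M[R[i]]_(#|X| * #|X|) :=
  \sum_(x : X) \sum_(y : X) 'e_(x, sigma x y) *t 'e_(y, tau y x).

Definition opV (x : X) : 'M[R[i]]_#|X| :=
  \sum_(y : X) 'e_(sigma x y, y).

Definition opW (x : X) : 'M[R[i]]_#|X| :=
  \sum_(eta : X) 'e_(tau x eta, eta).

Definition DeltaV (eta : X) : 'M[R[i]]_(#|X| * #|X|) :=
  \sum_(x : X) \sum_(y : X)
    'e_(sigma eta x, x) *t 'e_(sigma (tau x eta) y, y).

Definition DeltaW (y : X) : 'M[R[i]]_(#|X| * #|X|) :=
  \sum_(eta : X) \sum_(x : X)
    'e_(tau (sigma x y) eta, eta) *t 'e_(tau y x, x).

Definition twistF : 'M[R[i]]_(#|X| * #|X|) :=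
  \sum_(x : X) 'e_(x, x) *t opV x.

Definition twistFhat : 'M[R[i]]_(#|X| * #|X|) :=
  \sum_(y : X) opW y *t 'e_(y, y).

(* Conjugation by T, for invertible T; see [twistF_unit] and
   [twistFhat_unit]. *)
Definition twist (T A : 'M[R[i]]_(#|X| * #|X|)) : 'M[R[i]]_(#|X| * #|X|) :=
  T *m A *m invmx T.

Lemma mxe_mul (x y z w : X) :
  'e_(x, y) *m 'e_(z, w) = (if y == z then mxe R x w else 0).
Proof.
by rewrite /mxe mul_delta_mx_cond (inj_eq enum_rank_inj); case: (y == z).
Qed.

Lemma mxe_sum1 : \sum_(x : X) mxe R x x = 1%:M.
Proof.
rewrite (reindex (@enum_val X predT)) /=; last first.
  by exists enum_rank => ? _; [exact: enum_valK | exact: enum_rankK].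
apply/matrixP => i j; rewrite summxE (bigD1 i) //= big1 => [|k ki].
  by rewrite addr0 !mxE enum_valK eqxx eq_sym.
by rewrite !mxE !enum_valK eq_sym (negPf ki).
Qed.

Lemma perm_op_unit (f : X -> X) :
  bijective f -> (\sum_(y : X) mxe R (f y) y) *m (\sum_y 'e_(y, f y)) = 1%:M.
Proof.
move=> bijf; rewrite -mxe_sum1 [RHS](reindex f) /=; last exact: onW_bij.
rewrite mulmx_suml; apply: eq_bigr => y _; rewrite mulmx_sumr (bigD1 y) //=.
rewrite mxe_mul eqxx big1 ?addr0 // => z zy.
by rewrite mxe_mul eq_sym (negPf zy).
Qed.

Lemma mxe_tens_sum1 :
  (\sum_(x : X) mxe R x x *t 1%:M = 1%:M :> 'M[R[i]]_(#|X| * #|X|)) /\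
  (\sum_(x : X) 1%:M *t mxe R x x = 1%:M :> 'M[R[i]]_(#|X| * #|X|)).
Proof.
have one : 1%:M *t 1%:M = 1%:M :> 'M[R[i]]_(#|X| * #|X|).
  apply/matrixP => i j.
  case: (mxtens_indexP i) => a b; case: (mxtens_indexP j) => c d.
  rewrite tensmxE !mxE (inj_eq (can_inj (@mxtens_indexK _ _))) xpair_eqE.
  by rewrite -natrM mulnb.
split; rewrite -[RHS]one; apply/matrixP => i j.
  rewrite -{2}mxe_sum1 summxE [RHS]mxE summxE mulr_suml.
  by apply: eq_bigr => x _; rewrite mxE.
rewrite -{3}mxe_sum1 summxE [RHS]mxE summxE mulr_sumr.
by apply: eq_bigr => x _; rewrite mxE.
Qed.

Lemma twistF_unit : nondegenerate_pair sigma tau -> twistF \in unitmx.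
Proof.
case=> bs _; pose G : 'M[R[i]]_(#|X| * #|X|) :=
  \sum_(x : X) 'e_(x, x) *t (\sum_(y : X) 'e_(y, sigma x y)).
suff /mulmx1_unit[] : twistF *m G = 1%:M by [].
rewrite -mxe_tens_sum1.1 mulmx_suml; apply: eq_bigr => x _.
rewrite mulmx_sumr (bigD1 x) //= [X in _ + X]big1 => [|z zx].
  by rewrite addr0 tensmx_mul perm_op_unit // mxe_mul eqxx.
by rewrite tensmx_mul mxe_mul eq_sym (negPf zx) tens0mx.
Qed.

Lemma twistFhat_unit : nondegenerate_pair sigma tau -> twistFhat \in unitmx.
Proof.
case=> _ bt; pose G : 'M[R[i]]_(#|X| * #|X|) :=
  \sum_(y : X) (\sum_(x : X) 'e_(x, tau y x)) *t 'e_(y, y).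
suff /mulmx1_unit[] : twistFhat *m G = 1%:M by [].
rewrite -mxe_tens_sum1.2 mulmx_suml; apply: eq_bigr => y _.
rewrite mulmx_sumr (bigD1 y) //= [X in _ + X]big1 => [|z zy].
  by rewrite addr0 tensmx_mul perm_op_unit // mxe_mul eqxx.
by rewrite tensmx_mul mxe_mul eq_sym (negPf zy) tensmx0.
Qed.

End Operators.

(* Main.v *)
Require Import Defs.
From mathcomp Require Import all_boot all_order all_algebra.

(** All operators involved are sums of matrix units [e_(f p, g p)] indexed by
    the pairs [p] in X * X, for two self-maps [f] and [g] of X * X; write
    [graph_mx f g] for this sum.  The coproducts are the linearizations
    [graph_mx d id] of self-maps [d], the braiding is [graph_mx id s] with [s]
    the given solution, and the twists are [graph_mx t id] for the maps
    [t (x, y) = (x, sigma_x y)], respectively [(tau_y x, y)].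

    These maps [t] permute X * X, so conjugation by the twist relabels both
    indices: it turns [graph_mx f g] into [graph_mx (t \o f) (t \o g)]
    ([twist_graph_mx]).  The displayed formulas for the twisted operators are
    thus identities between self-maps of X * X, which the three component
    equations of the braid relation provide; for the two grouplike coproducts
    one also renames the summation index by [t].

    As for the commutation, the same component equations say that [s] commutes
    with the self-maps underlying the coproducts.  Those are permutations of
    X * X, and a permutation matrix that commutes with the matrix of a map
    commutes with its transpose ([graph_mx_comm]), which for [s] is the
    braiding.  Conjugating by the twist preserves this commutation. *)

Set Implicit Arguments.
Unset Strict Implicit.
Unset Printing Implicit Defensive.

Import GRing.Theory.
Local Open Scope ring_scope.

(** * Linear maps given by pairs of self-maps of X * X *)

Section GraphMatrices.
Context (R : realType) (X : finType).
Local Notation pair := (X * X)%type.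

Definition graph_mx (f g : pair -> pair) : 'M[R[i]]_(#|X| * #|X|) :=
  \sum_(p : pair) 'e_((f p).1, (g p).1) *t 'e_((f p).2, (g p).2).

Lemma mxe_tens_mul (p q u v : pair) :
  ('e_(p.1, q.1) *t 'e_(p.2, q.2)) *m ('e_(u.1, v.1) *t 'e_(u.2, v.2)) =
  if q == u then mxe R p.1 v.1 *t mxe R p.2 v.2 else 0.
Proof.
rewrite tensmx_mul !mxe_mul -pair_eqE /pair_eq.
by case: eqP => _ /=; [case: eqP => _ //=; exact: tensmx0 | exact: tens0mx].
Qed.

Lemma eq_graph_mx (f f' g g' : pair -> pair) :
  f =1 f' -> g =1 g' -> graph_mx f g = graph_mx f' g'.
Proof. by move=> ef eg; apply: eq_bigr => p _; rewrite ef eg. Qed.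

Lemma graph_mx_reindex (h f g : pair -> pair) :
  bijective h -> graph_mx f g = graph_mx (f \o h) (g \o h).
Proof. by move=> bh; rewrite /graph_mx (reindex h) //; exact: onW_bij. Qed.

Lemma graph_mx_mull (t f g : pair -> pair) :
  graph_mx t id *m graph_mx f g = graph_mx (t \o f) g.
Proof.
rewrite mulmx_sumr; apply: eq_bigr => p _.
rewrite mulmx_suml (bigD1 (f p)) //= big1 => [|q qf].
  by rewrite addr0 mxe_tens_mul eqxx.
by rewrite mxe_tens_mul (negPf qf).
Qed.

Lemma graph_mx_mulr (t f g : pair -> pair) :
  injective t -> graph_mx f (t \o g) *m graph_mx t id = graph_mx f g.
Proof.
move=> it; rewrite mulmx_suml; apply: eq_bigr => p _.
rewrite mulmx_sumr (bigD1 (g p)) //= big1 => [|q qg].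
  by rewrite addr0 mxe_tens_mul eqxx.
by rewrite mxe_tens_mul (inj_eq it) eq_sym (negPf qg).
Qed.

(** The right index follows [t] as well because the inverse of a permutation
    matrix is its transpose. *)
Lemma twist_graph_mx (t f g : pair -> pair) :
  injective t -> graph_mx t id \in unitmx ->
  twist (graph_mx t id) (graph_mx f g) = graph_mx (t \o f) (t \o g).
Proof.
move=> it uT; rewrite /twist graph_mx_mull -(graph_mx_mulr (t \o f) g it).
by rewrite mulmxK.
Qed.

(** Both products are [graph_mx d s]; for the one on the right, the sum
    defining [graph_mx id s] is first reindexed by the permutation [d]. *)
Lemma graph_mx_comm (d s : pair -> pair) :
  bijective d -> s \o d =1 d \o s ->
  graph_mx d id *m graph_mx id s = graph_mx id s *m graph_mx d id.
Proof.
move=> bd sd; rewrite graph_mx_mull (graph_mx_reindex id s bd).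
by rewrite (eq_graph_mx (frefl _) sd) graph_mx_mulr //; exact: bij_inj.
Qed.

End GraphMatrices.

Lemma twist_mul (R : realType) (X : finType)
    (T A B : 'M[R[i]]_(#|X| * #|X|)) :
  T \in unitmx -> twist T A *m twist T B = twist T (A *m B).
Proof. by move=> uT; rewrite /twist !mulmxA mulmxKV. Qed.

(** * Self-maps of X * X *)

(** The value of [a] determines [x], and then the fiber map [b x] determines
    [y]; on a finite set injectivity suffices. *)
Lemma bij_skew_l (X : finType) (a : X -> X) (b : X -> X -> X) :
  injective a -> (forall x, injective (b x)) ->
  bijective (fun p : X * X => (a p.1, b p.1 p.2)).
Proof.
move=> ia ib; apply: injF_bij => -[x y] [z w] /= [/ia <-].
by move/ib <-.
Qed.

Lemma bij_skew_r (X : finType) (a : X -> X) (b : X -> X -> X) :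
  injective a -> (forall y, injective (b y)) ->
  bijective (fun p : X * X => (b p.2 p.1, a p.2)).
Proof.
move=> ia ib; apply: injF_bij => -[x y] [z w] /= [+ /ia yw].
by rewrite -yw => /ib <-.
Qed.

(** The first two equations together say that the solution commutes with the
    map underlying the coproduct of V_e, the last two that it commutes with the
    one underlying the coproduct of W_y. *)
Lemma braid_components (X : finType) (sigma tau : X -> X -> X) (e x y : X) :
  braid_solution (pair_map sigma tau) ->
  [/\ sigma e (sigma x y) = sigma (sigma e x) (sigma (tau x e) y),
      tau (sigma (tau x e) y) (sigma e x) =
        sigma (tau (sigma x y) e) (tau y x)
    & tau y (tau x e) = tau (tau y x) (tau (sigma x y) e)].
Proof. by move=> /(_ (e, x, y)) [<- <- <-]. Qed.

(** * The operators as linearized self-maps *)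

Section Operators.
Context (R : realType) (X : finType) (sigma tau : X -> X -> X).
Local Notation pair := (X * X)%type.

Definition mapF (p : pair) : pair := (p.1, sigma p.1 p.2).
Definition mapFhat (p : pair) : pair := (tau p.2 p.1, p.2).
Definition mapDV (e : X) (p : pair) : pair :=
  (sigma e p.1, sigma (tau p.1 e) p.2).
Definition mapDW (y : X) (p : pair) : pair :=
  (tau (sigma p.2 y) p.1, tau y p.2).

Lemma tens_suml (I : finType) (A : I -> 'M[R[i]]_#|X|) (B : 'M[R[i]]_#|X|) :
  (\sum_i A i) *t B = \sum_i A i *t B.
Proof.
apply/matrixP => k l; rewrite mxE !summxE mulr_suml; apply: eq_bigr => i _.
by rewrite mxE.
Qed.

Lemma tens_sumr (I : finType) (A : 'M[R[i]]_#|X|) (B : I -> 'M[R[i]]_#|X|) :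
  A *t (\sum_i B i) = \sum_i A *t B i.
Proof.
apply/matrixP => k l; rewrite mxE !summxE mulr_sumr; apply: eq_bigr => i _.
by rewrite mxE.
Qed.

Lemma twistF_graph : twistF R sigma = graph_mx R mapF id.
Proof.
rewrite /graph_mx -(pair_bigA _ (fun x y => 'e_(x, x) *t 'e_(sigma x y, y))).
by apply: eq_bigr => x _; exact: tens_sumr.
Qed.

Lemma twistFhat_graph : twistFhat R tau = graph_mx R mapFhat id.
Proof.
rewrite /graph_mx -(pair_bigA _ (fun x y => 'e_(tau y x, x) *t 'e_(y, y))).
by rewrite exchange_big; apply: eq_bigr => y _; exact: tens_suml.
Qed.

Lemma rcheck_graph :
  rcheck R sigma tau = graph_mx R id (pair_map sigma tau).
Proof. exact: pair_bigA. Qed.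

Lemma DeltaV_graph e : DeltaV R sigma tau e = graph_mx R (mapDV e) id.
Proof. exact: pair_bigA. Qed.

Lemma DeltaW_graph y : DeltaW R sigma tau y = graph_mx R (mapDW y) id.
Proof. exact: pair_bigA. Qed.

Lemma opV_tens_graph x :
  opV R sigma x *t opV R sigma x =
  graph_mx R (fun p => (sigma x p.1, sigma x p.2)) id.
Proof.
rewrite tens_suml.
rewrite -[RHS](pair_bigA _ (fun y z => 'e_(sigma x y, y) *t 'e_(sigma x z, z))).
by apply: eq_bigr => y _; exact: tens_sumr.
Qed.

Lemma opW_tens_graph y :
  opW R tau y *t opW R tau y =
  graph_mx R (fun p => (tau y p.1, tau y p.2)) id.
Proof.
rewrite tens_suml.
rewrite -[RHS](pair_bigA _ (fun x z => 'e_(tau y x, x) *t 'e_(tau y z, z))).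
by apply: eq_bigr => x _; exact: tens_sumr.
Qed.

Context (nd : nondegenerate_pair sigma tau).

Lemma bij_mapF : bijective mapF.
Proof.
by apply: (@bij_skew_l X id sigma) => // x; exact: bij_inj (nd.1 x).
Qed.

Lemma bij_mapFhat : bijective mapFhat.
Proof.
by apply: (@bij_skew_r X id tau) => // y; exact: bij_inj (nd.2 y).
Qed.

Lemma bij_mapDV e : bijective (mapDV e).
Proof.
apply: (@bij_skew_l X (sigma e) (fun x => sigma (tau x e))) => [|x];
  exact: bij_inj (nd.1 _).
Qed.

Lemma bij_mapDW y : bijective (mapDW y).
Proof.
apply: (@bij_skew_r X (tau y) (fun x => tau (sigma x y))) => [|x];
  exact: bij_inj (nd.2 _).
Qed.

Lemma twistF_graph_mx (f g : pair -> pair) :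
  twist (twistF R sigma) (graph_mx R f g) =
  graph_mx R (mapF \o f) (mapF \o g).
Proof.
rewrite twistF_graph twist_graph_mx -?twistF_graph //.
  exact: bij_inj bij_mapF.
exact: twistF_unit nd.
Qed.

Lemma twistFhat_graph_mx (f g : pair -> pair) :
  twist (twistFhat R tau) (graph_mx R f g) =
  graph_mx R (mapFhat \o f) (mapFhat \o g).
Proof.
rewrite twistFhat_graph twist_graph_mx -?twistFhat_graph //.
  exact: bij_inj bij_mapFhat.
exact: twistFhat_unit nd.
Qed.

Context (braid : braid_solution (pair_map sigma tau)).

Lemma DeltaV_comm e :
  DeltaV R sigma tau e *m rcheck R sigma tau =
  rcheck R sigma tau *m DeltaV R sigma tau e.
Proof.
rewrite DeltaV_graph rcheck_graph; apply: graph_mx_comm => [|[x y]].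
  exact: bij_mapDV.
have [sss mid _] := braid_components e x y braid.
by rewrite /= /pair_map /mapDV /= sss mid.
Qed.

Lemma DeltaW_comm y :
  DeltaW R sigma tau y *m rcheck R sigma tau =
  rcheck R sigma tau *m DeltaW R sigma tau y.
Proof.
rewrite DeltaW_graph rcheck_graph; apply: graph_mx_comm => [|[e x]].
  exact: bij_mapDW.
have [_ mid ttt] := braid_components e x y braid.
by rewrite /= /pair_map /mapDW /= mid ttt.
Qed.

End Operators.

(** * Twisted coproducts and twisted braiding *)

Theorem lemma4p9 (R : realType) (X : finType) (sigma tau : X -> X -> X)
    (hbraid : braid_solution (pair_map sigma tau))
    (hnd : nondegenerate_pair sigma tau) :
  let F := twistF R sigma in
  let Fhat := twistFhat R tau in
  let V := opV R sigma in
  let W := opW R tau in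
  let DV := DeltaV R sigma tau in
  let DW := DeltaW R sigma tau in
  let r := rcheck R sigma tau in
  (forall (x : X) (T DY : 'M[R[i]]_(#|X| * #|X|)),
     T \in [:: F; Fhat] -> DY \in [:: DV x; DW x] ->
     twist T DY *m twist T r = twist T r *m twist T DY) /\
  (forall x : X, twist F (DV x) = V x *t V x) /\
  (forall y : X, twist F (DW y) =
     \sum_(eta : X) \sum_(x : X)
       'e_(tau (sigma x y) eta, eta) *t
       'e_(tau (sigma (tau x eta) y) (sigma eta x), sigma eta x)) /\
  (forall eta : X, twist Fhat (DV eta) =
     \sum_(x : X) \sum_(y : X)
       'e_(sigma (tau (sigma x y) eta) (tau y x), tau y x) *t
       'e_(sigma (tau x eta) y, y)) /\
  (forall y : X, twist Fhat (DW y) = W y *t W y) /\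
  twist F r =
    \sum_(x : X) \sum_(y : X)
      'e_(x, sigma x y) *t 'e_(sigma x y, sigma (sigma x y) (tau y x)) /\
  twist Fhat r =
    \sum_(x : X) \sum_(y : X)
      'e_(tau y x, tau (tau y x) (sigma x y)) *t 'e_(y, tau y x).
Proof.
move=> /=; split; last split; last split; last split; last split; last split.
- move=> x T DY TF DYx.
  have uT : T \in unitmx.
    by move: TF; rewrite !inE => /orP[] /eqP->;
      [exact: twistF_unit hnd | exact: twistFhat_unit hnd].
  rewrite !twist_mul //; congr twist.
  by move: DYx; rewrite !inE => /orP[] /eqP->;
    [exact: DeltaV_comm | exact: DeltaW_comm].
- move=> x; rewrite DeltaV_graph (twistF_graph_mx _ hnd) opV_tens_graph.
  rewrite [RHS](graph_mx_reindex _ _ _ (bij_mapF hnd)).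
  apply: eq_graph_mx => // -[z y]; rewrite /mapF /mapDV /=.
  by have [-> _ _] := braid_components x z y hbraid.
- move=> y; rewrite DeltaW_graph (twistF_graph_mx _ hnd) /graph_mx pair_bigA.
  apply: eq_bigr => -[e x] _; rewrite /mapF /mapDW /=.
  by have [_ -> _] := braid_components e x y hbraid.
- move=> e; rewrite DeltaV_graph (twistFhat_graph_mx _ hnd) /graph_mx pair_bigA.
  apply: eq_bigr => -[x y] _; rewrite /mapFhat /mapDV /=.
  by have [_ -> _] := braid_components e x y hbraid.
- move=> y; rewrite DeltaW_graph (twistFhat_graph_mx _ hnd) opW_tens_graph.
  rewrite [RHS](graph_mx_reindex _ _ _ (bij_mapFhat hnd)).
  apply: eq_graph_mx => // -[e x]; rewrite /mapFhat /mapDW /=.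
  by have [_ _ ->] := braid_components e x y hbraid.
- by rewrite rcheck_graph (twistF_graph_mx _ hnd) pair_bigA.
- by rewrite rcheck_graph (twistFhat_graph_mx _ hnd) pair_bigA.
Qed.
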